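(* Let $A\in\mathbb{R}^{n\times n}$ be a matrix all of whose eigenvalues lie in $\mathbb{C}\setminus(-\infty,0]$, let $\|\cdot\|$ be a consistent matrix norm, and suppose that $A\neq I$. For a given finite interval $[l,r]\subset\mathbb{R}$, let $$a=\frac{\tanh(\sinh(l))+1}{2},\qquad b=\frac{\tanh(\sinh(r))+1}{2}.$$ If $a\le \dfrac{1}{2\|A-I\|}$ and $b\ge \dfrac{2\|A^{-1}\|}{2\|A^{-1}\|+1}$, then $$\left\lVert \log(A)-(A-I)\int_l^r F_{\mathrm{DE}}(x)\,\mathrm{d}x\right\rVert\le \frac{3}{2}\,a\,\|A-I\|+\left(-\log(b)+\frac{1-b}{2b}\right)\|A-I\|\,\|A^{-1}\|.$$
   Context: $I$ is the $n\times n$ identity matrix. For $A\in\mathbb{R}^{n\times n}$ with all eigenvalues in $\mathbb{C}\setminus(-\infty,0]$, $\log(A)$ denotes the principal logarithm: the unique matrix $X$ with $\exp(X)=A$ all of whose eigenvalues lie in the strip $\{z\in\mathbb{C}:-\pi<\mathrm{Im}(z)<\pi\}$. A matrix norm is consistent if it is submultiplicative, $\|XY\|\le\|X\|\,\|Y\|$ (e.g. an operator $p$-norm or the Frobenius norm). For $x\in\mathbb{R}$, $$F_{\mathrm{DE}}(x):=\cosh(x)\,\mathrm{sech}^2(\sinh(x))\left[(1+\tanh(\sinh(x)))(A-I)+2I\right]^{-1},$$ where the matrix in brackets is nonsingular for every $x\in\mathbb{R}$ under the eigenvalue assumption on $A$. Integrals of matrix-valued functions are entrywise. $\log(b)$ for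 the scalar $b\in(0,1)$ is the natural logarithm. *)

(* Defs.v *)
From HB Require Import structures.
From mathcomp Require Import all_boot all_order all_algebra.
From mathcomp Require Import all_classical all_reals all_analysis.
From mathcomp Require Import complex.

Set Implicit Arguments.
Unset Strict Implicit.
Unset Printing Implicit Defensive.

Import Order.TTheory GRing.Theory Num.Theory.
Import numFieldNormedType.Exports.

Local Open Scope classical_set_scope.
Local Open Scope ring_scope.

Definition cosh (R : realType) (x : R) : R := (expR x + expR (- x)) / 2.

Definition sinh (R : realType) (x : R) : R := (expR x - expR (- x)) / 2.

Definition tanh (R : realType) (x : R) : R := sinh x / cosh x.

Definition sech (R : realType) (x : R) : R := (cosh x)^-1.

Record consistent_norm (R : realType) (n : nat) (N : 'M[R]_n -> R) : Prop :=
  ConsistentNorm {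
    consistent_norm_eq0 : forall X, N X = 0 -> X = 0;
    consistent_normZ : forall c X, N (c *: X) = `|c| * N X;
    consistent_normD : forall X Y, N (X + Y) <= N X + N Y;
    consistent_normM : forall X Y, N (X *m Y) <= N X * N Y }.

(* Complex eigenvalues of a real matrix. *)
Definition ceigenvalue (R : realType) (n : nat) (A : 'M[R]_n) (z : R[i]) : Prop :=
  eigenvalue (map_mx (real_complex R) A) z.

(* The limit is taken in the sup-norm topology of 'M[R]_n, that is, entrywise. *)
Definition expm (R : realType) (n : nat) (X : 'M[R]_n) : 'M[R]_n :=
  limn (series (fun k : nat => (k`!%:R : R)^-1 *: X ^+ k)).

Definition is_principal_log (R : realType) (n : nat) (A X : 'M[R]_n) : Prop :=
  expm X = A /\
  forall z : R[i], ceigenvalue X z -> - pi < complex.Im z < pi.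

(* For a real A without eigenvalues in (-oo, 0], the principal logarithm is
   unique among complex matrices, hence equal to its conjugate; so it is real
   and can be sought among real matrices. If no X qualifies, the value is
   unspecified. *)
Definition logm (R : realType) (n : nat) (A : 'M[R]_n) : 'M[R]_n :=
  get [set X | is_principal_log A X].

Definition F_DE (R : realType) (n : nat) (A : 'M[R]_n) (x : R) : 'M[R]_n :=
  (cosh x * sech (sinh x) ^+ 2) *:
    invmx ((1 + tanh (sinh x)) *: (A - 1%:M) + 2 *: 1%:M).

Definition mxintegral (R : realType) (n : nat) (l r : R) (F : R -> 'M[R]_n) :
    'M[R]_n :=
  \matrix_(i, j) (\int[lebesgue_measure]_(x in `[l, r]) F x i j)%R.

(* Main.v *)
Require Import Defs.
From mathcomp Require Import all_boot all_order all_algebra.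
From mathcomp Require Import all_classical all_reals all_analysis.
From mathcomp Require Import complex ring lra.

Set Implicit Arguments.
Unset Strict Implicit.
Unset Printing Implicit Defensive.

Import Order.TTheory GRing.Theory Num.Theory.
Import numFieldNormedType.Exports.

Local Open Scope ring_scope.

(** Write B = A - I. The resolvent (I + t B)^-1 exists for t in [0, 1], because
    its poles are the t with 1 - 1/t an eigenvalue of A, and 1 - 1/t <= 0 there.
    Let P be its primitive with P(0) = 0, and L(t) = B P(t). The substitution
    t = (tanh (sinh x) + 1) / 2 turns the integral of F_DE over [l, r] into
    P(b) - P(a) (lemma mxintegral_F_DE), so once log A = L(1) is known, the error
    is L(a) - L(0) plus L(1) - L(b), and each tail is estimated separately.

    Tails (lower_tail, upper_tail). The derivative X = B (I + t B)^-1 of L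
    satisfies X = B - t X B, so N(X) <= N(B) (1 + 2 t N(B)) as long as
    t N(B) <= 1/2. Near t = 1 the same trick applies to A^-1. A mean value
    inequality for an arbitrary seminorm (seminorm_mean_value) integrates these
    bounds.

    Why log A = L(1) (logmE). Three facts are needed.

    - exp (L(1)) = A: both exp (L(t)) and I + t B solve V' = L' V with V(0) = I
      (expm_log_path, from the general expm_flow). The exponential series is
      never differentiated; its partial sums satisfy the equation up to their
      last term.

    - The eigenvalues of L(1) lie in the strip (log_path_strip): on a common
      eigenvector with eigenvalue mu of A, L(1) acts as the integral of
      (mu - 1) / (1 + t (mu - 1)), whose imaginary part is an explicit difference
      of two arctangents.

    - A real matrix X with exp X = A and spectrum in the strip is L(1): X commutes
      with A, hence with L(1), and two commuting matrices with equal exponentials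
      and spectra in the strip are equal (expm_strip_inj), since they act on common
      eigenvectors by the same scalar and exp has no critical point.

    Complex eigenvectors are used in real form: v becomes the 2-row matrix of its
    real and imaginary parts, and an eigenvalue x + i y becomes a 2 x 2 real
    matrix, whose exponential is again given by expm_flow. Thus all limits and
    derivatives are those of real matrices. *)

(** * Differentiation of matrix functions and a mean value inequality *)

Section Calculus.
Local Open Scope classical_set_scope.
Context {R : realType}.

Definition is_mxderive {m n} (G : R -> 'M[R]_(m, n)) (t : R)
    (G' : 'M[R]_(m, n)) : Prop :=
  forall i j, is_derive t (1 : R) (fun s => G s i j) (G' i j).

Lemma is_mxderive_eq m n (G : R -> 'M[R]_(m, n)) t A B :
  is_mxderive G t A -> A = B -> is_mxderive G t B.
Proof. by move=> + <-. Qed.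

Lemma is_mxderive_cst m n (A : 'M[R]_(m, n)) t : is_mxderive (fun=> A) t 0.
Proof. by move=> i j; rewrite mxE; exact: is_derive_cst. Qed.

Lemma is_mxderiveD m n (F G : R -> 'M[R]_(m, n)) t F' G' :
  is_mxderive F t F' -> is_mxderive G t G' ->
  is_mxderive (fun s => F s + G s) t (F' + G').
Proof.
move=> dF dG i j; under eq_fun do rewrite mxE; rewrite mxE.
exact: (is_deriveD (dF i j) (dG i j)).
Qed.

Lemma is_mxderiveN m n (F : R -> 'M[R]_(m, n)) t F' :
  is_mxderive F t F' -> is_mxderive (fun s => - F s) t (- F').
Proof.
move=> dF i j; under eq_fun do rewrite mxE; rewrite mxE.
exact: (is_deriveN (dF i j)).
Qed.

Lemma is_mxderiveB m n (F G : R -> 'M[R]_(m, n)) t F' G' :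
  is_mxderive F t F' -> is_mxderive G t G' ->
  is_mxderive (fun s => F s - G s) t (F' - G').
Proof. by move=> dF dG; apply: is_mxderiveD dF _; exact: is_mxderiveN. Qed.

Lemma is_mxderiveM m n p (F : R -> 'M[R]_(m, n)) (G : R -> 'M[R]_(n, p))
    t F' G' :
  is_mxderive F t F' -> is_mxderive G t G' ->
  is_mxderive (fun s => F s *m G s) t (F' *m G t + F t *m G').
Proof.
move=> dF dG i j; under eq_fun do rewrite mxE.
rewrite (_ : (fun _ => _) = \sum_k (fun s => F s i k * G s k j)); last first.
  by apply/funext => s; rewrite fct_sumE.
rewrite !mxE -big_split/=; apply: is_derive_sum => k.
apply: is_derive_eq (is_deriveM (dF i k) (dG k j)) _.
by rewrite /GRing.scale/= addrC [G t k j * _]mulrC.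
Qed.

Lemma is_mxderiveMl m n p (A : 'M[R]_(m, n)) (G : R -> 'M[R]_(n, p)) t G' :
  is_mxderive G t G' -> is_mxderive (fun s => A *m G s) t (A *m G').
Proof.
move=> dG; apply: is_mxderive_eq (is_mxderiveM (is_mxderive_cst A t) dG) _.
by rewrite mul0mx add0r.
Qed.

Lemma is_mxderiveMr m n p (A : 'M[R]_(n, p)) (G : R -> 'M[R]_(m, n)) t G' :
  is_mxderive G t G' -> is_mxderive (fun s => G s *m A) t (G' *m A).
Proof.
move=> dG; apply: is_mxderive_eq (is_mxderiveM dG (is_mxderive_cst A t)) _.
by rewrite mulmx0 addr0.
Qed.

Lemma is_mxderiveZ m n (f : R -> R) (A : 'M[R]_(m, n)) t f' :
  is_derive t (1 : R) f f' -> is_mxderive (fun s => f s *: A) t (f' *: A).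
Proof.
move=> df i j; under eq_fun do rewrite mxE; rewrite mxE.
apply: is_derive_eq (is_deriveM df (is_derive_cst (A i j) t 1)) _.
by rewrite scaler0 add0r /GRing.scale/= mulrC.
Qed.

Lemma is_mxderive_scale m n (c : R) (G : R -> 'M[R]_(m, n)) t G' :
  is_mxderive G t G' -> is_mxderive (fun s => c *: G s) t (c *: G').
Proof.
move=> dG i j; under eq_fun do rewrite mxE; rewrite mxE.
exact: (is_deriveZ c (dG i j)).
Qed.

Lemma is_mxderive_sum m n k (G : nat -> R -> 'M[R]_(m, n)) t
    (G' : nat -> 'M[R]_(m, n)) :
  (forall l, is_mxderive (G l) t (G' l)) ->
  is_mxderive (fun s => \sum_(0 <= l < k) G l s) t (\sum_(0 <= l < k) G' l).
Proof.
move=> dG; elim: k => [|k IHk].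
  rewrite big_nil; under eq_fun do rewrite big_nil; exact: is_mxderive_cst.
rewrite big_nat_recr//=; under eq_fun do rewrite big_nat_recr//=.
exact: is_mxderiveD.
Qed.

(** Real induction: a local upper bound on increments propagates to the whole
    segment, since the points up to which it holds have a last one. *)
Lemma increment_le0 (phi : R -> R) (p q : R) : p <= q ->
  (forall t e : R, p <= t <= q -> 0 < e -> exists2 d : R, 0 < d &
    forall u v : R, p <= u -> u <= t -> t <= v -> v <= q -> t - d < u -> v < t + d ->
    phi v - phi u <= e * (v - u)) ->
  phi q <= phi p.
Proof.
move=> pq loc; apply/ler_addgt0Pl => e e0.
have e'0 : 0 < e / (q - p + 1) by rewrite divr_gt0// ltr_wpDl// subr_ge0.
set e' : R := e / _ in e'0.
pose S := [set t | p <= t <= q /\ phi t - phi p <= e' * (t - p)].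
have Sp : S p by split; rewrite ?lexx// !subrr mulr0.
have supS : has_sup S.
  by split; [exists p|exists q => t [/andP[]]].
have pc : p <= sup S by exact: (sup_upper_bound supS).
have cq : sup S <= q by apply: ge_sup; [exists p|move=> t [/andP[]]].
set c := sup S in pc cq *.
have [d d0 dP] := loc c e' (introT andP (conj pc cq)) e'0.
have Sc : S c.
  split; first by rewrite pc cq.
  have [s [/andP[ps sq] sS] cds] := sup_adherent d0 supS.
  have sc : s <= c by apply: (sup_upper_bound supS); split; rewrite ?ps.
  have := dP s c ps sc (lexx _) cq cds (_ : c < c + d).
  by rewrite ltrDl => /(_ d0); move: sS; nra.
have [qc|cltq] := leP q c.
  have -> : q = c by apply/le_anti; rewrite qc.
  case: Sc => _ H; rewrite -lerBlDr (le_trans H)//.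
  rewrite /e' mulrAC ler_pdivrMr; last by rewrite ltr_wpDl// subr_ge0.
  by apply: ler_wpM2l; [exact: ltW|lra].
exfalso; pose s := Num.min (c + d / 2) q.
have cs : c < s by rewrite lt_min cltq andbT; lra.
have sq : s <= q by rewrite ge_min lexx orbT.
have sd : s < c + d.
  by apply: (@le_lt_trans _ _ (c + d / 2)); [rewrite ge_min lexx|lra].
have ss : S s.
  split; first by rewrite sq andbT (le_trans pc)// ltW.
  have cdc : c - d < c by lra.
  by have := dP c s pc (lexx _) (ltW cs) sq cdc sd; case: Sc => _; nra.
by have := sup_upper_bound supS ss; rewrite leNgt cs.
Qed.

Definition seminorm {m n} (N : 'M[R]_(m, n) -> R) : Prop :=
  (forall c X, N (c *: X) = `|c| * N X) /\ (forall X Y, N (X + Y) <= N X + N Y).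

Section Seminorm.
Context {m n : nat} (N : 'M[R]_(m, n) -> R).
Hypothesis sN : seminorm N.

Lemma seminorm0 : N 0 = 0.
Proof. by rewrite -(scale0r 0) sN.1 normr0 mul0r. Qed.

Lemma seminormN X : N (- X) = N X.
Proof. by rewrite -scaleN1r sN.1 normrN1 mul1r. Qed.

Lemma seminorm_ge0 X : 0 <= N X.
Proof.
have := sN.2 X (- X); rewrite subrr seminorm0 seminormN; lra.
Qed.

Lemma seminormB X Y : N (X - Y) <= N X + N Y.
Proof. by rewrite -(seminormN Y); exact: sN.2. Qed.

Lemma seminorm_sum I (r : seq I) (P : pred I) (F : I -> 'M[R]_(m, n)) :
  N (\sum_(i <- r | P i) F i) <= \sum_(i <- r | P i) N (F i).
Proof.
elim/big_rec2: _ => [|i x y _ xy]; first by rewrite seminorm0.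
by apply: le_trans (sN.2 _ _) _; rewrite lerD2l.
Qed.

(** All seminorms are controlled by the entries, by expanding on the standard
    basis. *)
Lemma seminorm_le_entries : exists2 K : R, 0 <= K &
  forall (X : 'M[R]_(m, n)) (e : R), (forall i j, `|X i j| <= e) -> N X <= K * e.
Proof.
exists (\sum_i \sum_j N (delta_mx i j)).
  by do 2![apply: sumr_ge0 => ? _]; exact: seminorm_ge0.
move=> X e Xe; rewrite [X in N X]matrix_sum_delta mulr_suml.
apply: le_trans (seminorm_sum _ _ _) _; apply: ler_sum => i _.
rewrite mulr_suml; apply: le_trans (seminorm_sum _ _ _) _.
apply: ler_sum => j _; rewrite sN.1 mulrC.
by rewrite ler_wpM2l// seminorm_ge0.
Qed.

End Seminorm.

Lemma is_derive_increment (f : R -> R) t df e : is_derive t (1 : R) f df ->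
  0 < e -> \forall s \near t, `|f s - f t - (s - t) * df| <= e * `|s - t|.
Proof.
move=> /is_derive1_caratheodory[g [fE cg <-]] e0.
have : \forall s \near t, `|g t - g s| < e by move/cvgrPdist_lt : cg; exact.
apply: filterS => s gs; rewrite fE [_ * g t]mulrC -mulrBl normrM.
by rewrite ler_wpM2r// distrC ltW.
Qed.

(** The fundamental theorem of calculus as an inequality, for a norm that need
    not come from an inner product: no mean value point exists, but increments
    are still bounded by the increments of a primitive of the bound. *)
Lemma seminorm_mean_value m n (N : 'M[R]_(m, n) -> R) (G : R -> 'M[R]_(m, n))
    (G' : R -> 'M[R]_(m, n)) (g g' : R -> R) p q :
  seminorm N -> p <= q ->
  (forall t, p <= t <= q -> is_mxderive G t (G' t)) ->
  (forall t, p <= t <= q -> is_derive t (1 : R) g (g' t)) ->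
  (forall t, p <= t <= q -> N (G' t) <= g' t) ->
  N (G q - G p) <= g q - g p.
Proof.
move=> sN pq dG dg NG.
suff : N (G q - G p) - g q <= N (G p - G p) - g p.
  by rewrite subrr (seminorm0 sN); lra.
apply: (increment_le0 (phi := fun s => N (G s - G p) - g s)) => // t e tpq e0.
have [K K0 NK] := seminorm_le_entries sN.
pose e' : R := e / (2 * (K + 1)).
have e'0 : 0 < e' by rewrite divr_gt0//; lra.
have Ke' : K * e' <= e / 2.
  rewrite /e' mulrA ler_pdivrMr; last by lra.
  by nra.
have [d /= d0 dP] : \forall s \near t,
    (forall i j, `|(G s - G t - (s - t) *: G' t) i j| <= e' * `|s - t|) /\
    `|g s - g t - (s - t) * g' t| <= e / 2 * `|s - t|.
  apply: filterI; last by apply: is_derive_increment; [exact: dg|lra].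
  apply: (@filter_forall R _ _ (nbhs t)) => i.
  apply: (@filter_forall R _ _ (nbhs t)) => j.
  have := is_derive_increment (dG _ tpq i j) e'0.
  by apply: filterS => s; rewrite !mxE.
exists d => // u v pu ut tv vq tdu vtd.
have [/NK Gu gu] : (forall i j, `|(G u - G t - (u - t) *: G' t) i j|
      <= e' * `|u - t|) /\ `|g u - g t - (u - t) * g' t| <= e / 2 * `|u - t|.
  by apply: dP; rewrite /= ger0_norm; lra.
have [/NK Gv gv] : (forall i j, `|(G v - G t - (v - t) *: G' t) i j|
      <= e' * `|v - t|) /\ `|g v - g t - (v - t) * g' t| <= e / 2 * `|v - t|.
  by apply: dP; rewrite /= ler0_norm; lra.
rewrite !(ler0_norm (_ : u - t <= 0)) ?subr_le0// in Gu gu.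
rewrite !(ger0_norm (_ : 0 <= v - t)) ?subr_ge0// in Gv gv.
have ut' : 0 <= t - u by lra.
have vt' : 0 <= v - t by lra.
have Guv : N (G v - G u) <= (v - u) * N (G' t) + e / 2 * (v - u).
  have -> : G v - G u = (v - u) *: G' t + (G v - G t - (v - t) *: G' t)
                        - (G u - G t - (u - t) *: G' t).
    by apply/matrixP => i j; rewrite !mxE; ring.
  apply: le_trans (seminormB sN _ _) _.
  have := sN.2 ((v - u) *: G' t) (G v - G t - (v - t) *: G' t).
  rewrite sN.1 ger0_norm; last by lra.
  by nra.
have := sN.2 (G v - G u) (G u - G p); rewrite subrKA.
have := NG _ tpq; move: gu gv; rewrite !ler_norml => /andP[gu1 gu2] /andP[gv1 gv2].
by nra.
Qed.

End Calculus.

(** * The matrix exponential *)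

Section Exponential.
Local Open Scope classical_set_scope.
Context {R : realType}.

Definition nrm {m n} (X : 'M[R]_(m, n)) : R := \sum_i \sum_j `|X i j|.

Lemma nrm_seminorm m n : seminorm (@nrm m n).
Proof.
split=> [c X|X Y].
  rewrite /nrm mulr_sumr; apply: eq_bigr => i _; rewrite mulr_sumr.
  by apply: eq_bigr => j _; rewrite mxE normrM.
rewrite /nrm -big_split; apply: ler_sum => i _; rewrite -big_split.
by apply: ler_sum => j _; rewrite mxE ler_normD.
Qed.

Lemma nrm_ge0 m n (X : 'M[R]_(m, n)) : 0 <= nrm X.
Proof. exact: seminorm_ge0 (nrm_seminorm m n) _. Qed.

Lemma le_entry_nrm m n (X : 'M[R]_(m, n)) i j : `|X i j| <= nrm X.
Proof.
rewrite /nrm (bigD1 i)//= (bigD1 j)//= -addrA lerDl.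
by rewrite addr_ge0// ?sumr_ge0// => k _; rewrite sumr_ge0.
Qed.

Lemma nrm_le0 m n (X : 'M[R]_(m, n)) : nrm X <= 0 -> X = 0.
Proof.
move=> X0; apply/matrixP => i j; rewrite mxE.
by apply/eqP; rewrite -normr_le0 (le_trans (le_entry_nrm _ _ _)).
Qed.

Lemma nrmM m n p (X : 'M[R]_(m, n)) (Y : 'M[R]_(n, p)) :
  nrm (X *m Y) <= nrm X * nrm Y.
Proof.
apply: (@le_trans _ _ (\sum_i \sum_k \sum_j `|X i j| * `|Y j k|)).
  apply: ler_sum => i _; apply: ler_sum => k _; rewrite mxE.
  by apply: le_trans (ler_norm_sum _ _ _) _; apply: ler_sum => j _; rewrite normrM.
rewrite /nrm mulr_suml; apply: ler_sum => i _.
rewrite exchange_big/= mulr_suml; apply: ler_sum => j _.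
rewrite -mulr_sumr ler_wpM2l// (bigD1 j)//= lerDl.
by rewrite sumr_ge0// => k _; rewrite sumr_ge0.
Qed.

Lemma nrmX n (X : 'M[R]_n) k : nrm (X ^+ k) <= nrm (1%:M : 'M[R]_n) * nrm X ^+ k.
Proof.
elim: k => [|k IHk]; first by rewrite !expr0 mulr1.
rewrite !exprS mulrCA; apply: le_trans (nrmM _ _) _.
by rewrite ler_wpM2l// nrm_ge0.
Qed.

Lemma is_mxderive_0_is_cst m n (G : R -> 'M[R]_(m, n)) p q : p <= q ->
  (forall t, p <= t <= q -> is_mxderive G t 0) -> G q = G p.
Proof.
move=> pq dG; apply/eqP; rewrite -subr_eq0; apply/eqP/nrm_le0.
have := @seminorm_mean_value _ _ _ (@nrm m n) G (fun=> 0) (fun=> 0) (fun=> 0)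
  p q (nrm_seminorm m n) pq dG.
rewrite subrr; apply=> t _; last by rewrite (seminorm0 (nrm_seminorm m n)).
Qed.

Lemma cvg_mxP m n (u : nat -> 'M[R]_(m, n)) (l : 'M[R]_(m, n)) :
  u @ \oo --> l <-> forall i j, u k i j @[k --> \oo] --> l i j.
Proof.
split=> [ul i j|ul B [P lP sPB]].
  exact: (cvg_comp _ _ ul (@coord_continuous R m n i j l)).
apply: filterS sPB _ => //=.
apply: (@filter_forall nat _ _ \oo) => i.
by apply: (@filter_forall nat _ _ \oo) => j; exact: ul (lP i j).
Qed.

Lemma cvg_mulmx m n p (u : nat -> 'M[R]_(m, n)) (v : nat -> 'M[R]_(n, p))
    (a : 'M[R]_(m, n)) (b : 'M[R]_(n, p)) :
  u @ \oo --> a -> v @ \oo --> b -> u k *m v k @[k --> \oo] --> a *m b.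
Proof.
move=> /cvg_mxP ua /cvg_mxP vb; apply/cvg_mxP => i j.
under eq_fun do rewrite mxE; rewrite mxE.
apply: (@cvg_big _ _ +%R) => [|k _]; first exact: add_continuous.
exact: cvgM.
Qed.

Lemma cvg_mx_nrm m n (u : nat -> 'M[R]_(m, n)) (l : 'M[R]_(m, n))
    (e : nat -> R) :
  (forall k, nrm (u k - l) <= e k) -> e @ \oo --> (0 : R) -> u @ \oo --> l.
Proof.
move=> ule e0; apply/cvg_mxP => i j; apply/cvgrPdist_le => eps eps0.
have : \forall k \near \oo, `|0 - e k| <= eps by move/cvgrPdist_le : e0; exact.
apply: filterS => k; rewrite sub0r normrN => /(le_trans (ler_norm _)).
apply: le_trans; apply: le_trans (ule k).
by have := le_entry_nrm (u k - l) i j; rewrite !mxE distrC.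
Qed.

Definition expm_term {n} (k : nat) (X : 'M[R]_n) : 'M[R]_n :=
  (k`!%:R : R)^-1 *: X ^+ k.

Definition expm_part {n} (m : nat) (X : 'M[R]_n) : 'M[R]_n :=
  \sum_(0 <= k < m) expm_term k X.

Lemma expm_partS n m (X : 'M[R]_n) :
  expm_part m.+1 X = expm_part m X + expm_term m X.
Proof. by rewrite /expm_part big_nat_recr. Qed.

Lemma expm_part0 n m : expm_part m.+1 (0 : 'M[R]_n) = 1%:M.
Proof.
rewrite /expm_part big_nat_recl// big1 ?addr0 => [|k _].
  by rewrite /expm_term expr0 fact0 invr1 scale1r.
by rewrite /expm_term expr0n scaler0.
Qed.

Lemma nrm_expm_term n k (X : 'M[R]_n) (c : R) : nrm X <= c ->
  nrm (expm_term k X) <= nrm (1%:M : 'M[R]_n) * exp_coeff c k.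
Proof.
move=> Xc; rewrite (nrm_seminorm n n).1 ger0_norm ?invr_ge0//.
rewrite /exp_coeff/= mulrA [leRHS]mulrC ler_wpM2l ?invr_ge0//.
apply: le_trans (nrmX _ _) _; rewrite ler_wpM2l ?nrm_ge0//.
by rewrite lerXn2r// nnegrE ?nrm_ge0// (le_trans (nrm_ge0 X)).
Qed.

Lemma nrm_expm_part n m (X : 'M[R]_n) (c : R) : nrm X <= c ->
  nrm (expm_part m X) <= nrm (1%:M : 'M[R]_n) * expR c.
Proof.
move=> Xc; have c0 : 0 <= c by rewrite (le_trans (nrm_ge0 X)).
apply: (@le_trans _ _ (nrm (1%:M : 'M[R]_n) * series (exp_coeff c) m)).
  apply: le_trans (seminorm_sum (nrm_seminorm n n) _ _ _) _.
  by rewrite /series/= mulr_sumr; apply: ler_sum => k _; exact: nrm_expm_term.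
rewrite ler_wpM2l ?nrm_ge0//; apply: nondecreasing_cvgn_le.
  by apply: nondecreasing_series => k _ _; exact: exp_coeff_ge0.
exact: is_cvg_series_exp_coeff.
Qed.

Lemma expm_cvg n (X : 'M[R]_n) : expm_part^~ X @ \oo --> expm X.
Proof.
suff : cvgn (expm_part^~ X) by [].
apply/cvg_ex; exists (\matrix_(i, j) limn (fun m => expm_part m X i j)).
apply/cvg_mxP => i j; rewrite mxE.
rewrite (_ : (fun m => _) = series (fun k => expm_term k X i j)); last first.
  by apply/funext => m; rewrite /expm_part summxE.
apply: normed_cvg; apply: (series_le_cvg (v_ := fun k =>
  nrm (1%:M : 'M[R]_n) * exp_coeff (nrm X) k)) => [k|k|k|].
- exact: normr_ge0.
- by rewrite mulr_ge0 ?nrm_ge0// exp_coeff_ge0 ?nrm_ge0.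
- by rewrite /=; apply: le_trans (le_entry_nrm _ _ _) _; exact: nrm_expm_term.
rewrite (_ : series _ = fun m => nrm (1%:M : 'M[R]_n) *
    series (exp_coeff (nrm X)) m); last first.
  by apply/funext => m; rewrite /series/= mulr_sumr.
by apply: is_cvgMr; exact: is_cvg_series_exp_coeff.
Qed.

Lemma intertwineX m n (X : 'M[R]_m) (Y : 'M[R]_n) (W : 'M[R]_(m, n)) k :
  X *m W = W *m Y -> X ^+ k *m W = W *m Y ^+ k.
Proof.
move=> XW; elim: k => [|k IHk]; first by rewrite !expr0 mul1mx mulmx1.
rewrite [X ^+ _]exprSr [Y ^+ _]exprSr -[_ * X]/(_ *m X) -[_ * Y]/(_ *m Y).
by rewrite -mulmxA XW mulmxA IHk mulmxA.
Qed.

Lemma expm_part_intertwine m n (X : 'M[R]_m) (Y : 'M[R]_n) (W : 'M[R]_(m, n)) k :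
  X *m W = W *m Y -> expm_part k X *m W = W *m expm_part k Y.
Proof.
move=> XW; rewrite mulmx_suml mulmx_sumr; apply: eq_bigr => l _.
by rewrite -scalemxAl -scalemxAr (intertwineX _ XW).
Qed.

(** The exponential is a limit of polynomials, so it inherits every linear
    relation X W = W Y; rectangular W make it restrict to invariant subspaces,
    and X = Y gives the commutants. *)
Lemma expm_intertwine m n (X : 'M[R]_m) (Y : 'M[R]_n) (W : 'M[R]_(m, n)) :
  X *m W = W *m Y -> expm X *m W = W *m expm Y.
Proof.
move=> XW; have WY : W *m expm_part k Y @[k --> \oo] --> W *m expm Y.
  by apply: cvg_mulmx (@expm_cvg _ Y); exact: cvg_cst.
have XW' : expm_part k X *m W @[k --> \oo] --> expm X *m W.
  by apply: cvg_mulmx (@expm_cvg _ X) _; exact: cvg_cst.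
move: XW'; under eq_fun do rewrite (expm_part_intertwine _ XW).
by move/cvg_unique; apply.
Qed.

Lemma is_mxderiveX n (Y : R -> 'M[R]_n) t Y' k :
  is_mxderive Y t Y' -> Y t *m Y' = Y' *m Y t ->
  is_mxderive (fun s => Y s ^+ k.+1) t (k.+1%:R *: (Y' *m Y t ^+ k)).
Proof.
move=> dY cY; elim: k => [|k IHk].
  by rewrite expr0 mulmx1 scale1r; under eq_fun do rewrite expr1.
under eq_fun do rewrite exprS.
apply: is_mxderive_eq (is_mxderiveM dY IHk) _.
rewrite -scalemxAr mulmxA cY -mulmxA -[Y t *m _]exprS.
by rewrite -[in RHS]natr1 scalerDl scale1r addrC.
Qed.

Lemma is_mxderive_expm_term n (Y : R -> 'M[R]_n) t Y' k :
  is_mxderive Y t Y' -> Y t *m Y' = Y' *m Y t ->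
  is_mxderive (fun s => expm_term k.+1 (Y s)) t (Y' *m expm_term k (Y t)).
Proof.
move=> dY cY; rewrite /expm_term.
apply: is_mxderive_eq (is_mxderive_scale _ (is_mxderiveX k dY cY)) _.
rewrite scalerA -scalemxAr factS natrM invfM mulrAC mulVf ?mul1r// pnatr_eq0.
Qed.

Lemma is_mxderive_expm_part n (Y : R -> 'M[R]_n) t Y' m :
  is_mxderive Y t Y' -> Y t *m Y' = Y' *m Y t ->
  is_mxderive (fun s => expm_part m.+1 (Y s)) t (Y' *m expm_part m (Y t)).
Proof.
move=> dY cY; rewrite /expm_part mulmx_sumr.
under eq_fun do rewrite big_nat_recl// /expm_term expr0.
apply: is_mxderive_eq (is_mxderiveD (is_mxderive_cst _ _) _) (add0r _).
by apply: is_mxderive_sum => k; exact: is_mxderive_expm_term.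
Qed.

(** Differentiating the exponential series itself would require uniform
    convergence. For its partial sums the product with a solution V of
    V' = Y' V is almost constant: all that is left of the derivative is the last
    term of the sum, which tends to 0. *)
Lemma expm_transport n (Y Y' V : R -> 'M[R]_n) (K : R) :
  (forall t, 0 <= t <= 1 ->
    [/\ is_mxderive Y t (Y' t), is_mxderive V t (Y' t *m V t) &
        Y t *m Y' t = Y' t *m Y t]) ->
  (forall t, 0 <= t <= 1 -> [/\ nrm (Y t) <= K, nrm (Y' t) <= K & nrm (V t) <= K]) ->
  Y 0 = 0 -> expm (- Y 1) *m V 1 = V 0.
Proof.
move=> dYV bYV Y0.
have K0 : 0 <= K.
  by have [|/(le_trans (nrm_ge0 _))] := bYV 0; rewrite ?lexx ?ler01.
pose U m t := expm_part m.+1 (- Y t) *m V t.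
pose e m := K * (nrm (1%:M : 'M[R]_n) * exp_coeff K m) * K.
have lU : U m 1 @[m --> \oo] --> expm (- Y 1) *m V 1.
  apply: cvg_mulmx; last exact: cvg_cst.
  by rewrite (cvg_shiftS (expm_part^~ (- Y 1))); exact: expm_cvg.
apply: (cvg_unique _ lU) => //=.
apply: (cvg_mx_nrm (e := e)) => [m|]; last first.
  rewrite -(mul0r K); apply: cvgMl; rewrite -(mulr0 K); apply: cvgMr.
  by rewrite -(mulr0 (nrm (1%:M : 'M[R]_n))); apply: cvgMr; exact: cvg_exp_coeff.
have -> : V 0 = U m 0 by rewrite /U Y0 oppr0 expm_part0 mul1mx.
have -> : e m = e m * 1 - e m * 0 by rewrite mulr0 subr0 mulr1.
apply: (seminorm_mean_value (G' := fun t =>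
    Y' t *m expm_term m (- Y t) *m V t) (g := fun t => e m * t)
    (g' := fun=> e m) (nrm_seminorm n n) ler01) => t t01.
- have [dY dV cY] := dYV _ t01.
  have cY' : - Y t *m - Y' t = - Y' t *m - Y t.
    by rewrite !mulmxN !mulNmx cY.
  apply: is_mxderive_eq
    (is_mxderiveM (is_mxderive_expm_part m (is_mxderiveN dY) cY') dV) _.
  have cE : expm_part m.+1 (- Y t) *m Y' t = Y' t *m expm_part m.+1 (- Y t).
    by apply: expm_part_intertwine; rewrite mulNmx mulmxN cY.
  by rewrite mulmxA cE -mulmxDl expm_partS mulNmx mulmxDr addKr.
- apply: is_derive_eq (is_deriveZ (e m) (is_derive_id t 1)) _.
  by rewrite /GRing.scale/= mulr1.
have [YK Y'K VK] := bYV _ t01.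
apply: le_trans (nrmM _ _) _; rewrite ler_pM ?nrm_ge0//.
apply: le_trans (nrmM _ _) _; rewrite ler_pM ?nrm_ge0// nrm_expm_term//.
by rewrite (seminormN (nrm_seminorm n n)).
Qed.

(** Same mechanism: the derivative of the product of the partial sums at t X and
    - t X only retains their last terms. *)
Lemma expmN n (X : 'M[R]_n) : expm X *m expm (- X) = 1%:M.
Proof.
pose U m (t : R) := expm_part m.+1 (t *: X) *m expm_part m.+1 (t *: - X).
pose N1 := nrm (1%:M : 'M[R]_n); pose K := nrm X.
pose d m := N1 * expR K * (N1 * exp_coeff K m).
pose e m := K * (d m + d m).
have lU : U m 1 @[m --> \oo] --> expm X *m expm (- X).
  rewrite /U !scale1r; apply: cvg_mulmx.
    by rewrite (cvg_shiftS (expm_part^~ X)); exact: expm_cvg.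
  by rewrite (cvg_shiftS (expm_part^~ (- X))); exact: expm_cvg.
apply: (cvg_unique _ lU) => //=.
have d0 : d @ \oo --> (0 : R).
  rewrite -(mulr0 (N1 * expR K)); apply: cvgMr.
  by rewrite -(mulr0 N1); apply: cvgMr; exact: cvg_exp_coeff.
apply: (cvg_mx_nrm (e := e)) => [m|]; last first.
  by rewrite -(mulr0 K); apply: cvgMr; rewrite -(addr0 0); exact: cvgD.
have -> : 1%:M = U m 0 by rewrite /U !scale0r !expm_part0 mulmx1.
have -> : e m = e m * 1 - e m * 0 by rewrite mulr0 subr0 mulr1.
apply: (seminorm_mean_value (G' := fun t =>
    X *m (expm_part m (t *: X) *m expm_term m (t *: - X)
          - expm_term m (t *: X) *m expm_part m (t *: - X)))
    (g := fun t => e m * t) (g' := fun=> e m) (nrm_seminorm n n) ler01) => t t01.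
- have dZ (Z : 'M[R]_n) : is_mxderive (fun s : R => s *: Z) t Z.
    by rewrite -[X in is_mxderive _ _ X]scale1r; apply: is_mxderiveZ.
  have cZ (Z : 'M[R]_n) : t *: Z *m Z = Z *m (t *: Z).
    by rewrite -scalemxAl -scalemxAr.
  apply: is_mxderive_eq (is_mxderiveM (is_mxderive_expm_part m (dZ X) (cZ X))
    (is_mxderive_expm_part m (dZ (- X)) (cZ (- X)))) _.
  have cE : expm_part m.+1 (t *: X) *m X = X *m expm_part m.+1 (t *: X).
    exact: expm_part_intertwine.
  rewrite mulNmx mulmxN mulmxA cE -!mulmxA -mulmxBr !expm_partS.
  by congr (X *m _); rewrite mulmxDr mulmxDl opprD addrACA subrr add0r.
- apply: is_derive_eq (is_deriveZ (e m) (is_derive_id t 1)) _.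
  by rewrite /GRing.scale/= mulr1.
have tZ (Z : 'M[R]_n) : nrm Z = K -> nrm (t *: Z) <= K.
  move: t01 => /andP[t0 t1] ZK; rewrite (nrm_seminorm n n).1 ger0_norm//.
  by rewrite ZK ler_piMl// -ZK nrm_ge0.
have tX := tZ X erefl.
have tNX := tZ (- X) (seminormN (nrm_seminorm n n) X).
apply: le_trans (nrmM _ _) _; rewrite ler_wpM2l ?nrm_ge0//.
apply: le_trans (seminormB (nrm_seminorm n n) _ _) _; apply: lerD.
  apply: le_trans (nrmM _ _) _.
  by rewrite ler_pM ?nrm_ge0// ?nrm_expm_part// nrm_expm_term.
apply: le_trans (nrmM _ _) _; rewrite /d mulrC.
by rewrite ler_pM ?nrm_ge0// ?nrm_expm_part// nrm_expm_term.
Qed.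

Lemma is_mxderive_continuous m n (G : R -> 'M[R]_(m, n)) t G' :
  is_mxderive G t G' -> forall i j, {for t, continuous (fun s => G s i j)}.
Proof.
by move=> dG i j; apply/differentiable_continuous/derivable1_diffP; case: (dG i j).
Qed.

Lemma nrm_bounded m n (G : R -> 'M[R]_(m, n)) (a b : R) : a <= b ->
  (forall t, a <= t <= b -> forall i j, {for t, continuous (fun s => G s i j)}) ->
  exists K, forall t, a <= t <= b -> nrm (G t) <= K.
Proof.
move=> ab cG; have [|c _ Hc] := @EVT_max R (fun t => nrm (G t)) a b ab.
  apply: continuous_in_subspaceT => t /set_mem/=; rewrite in_itv/= => tab.
  apply: (@cvg_big _ _ +%R) => [|i _]; first exact: add_continuous.
  apply: (@cvg_big _ _ +%R) => [|j _]; first exact: add_continuous.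
  by apply: cvg_norm; exact: cG.
by exists (nrm (G c)) => t tab; apply: Hc; rewrite in_itv.
Qed.

(** Exponentials are computed by exhibiting their flow: this serves both for the
    matrix logarithm and for the conformal matrices of the plane. *)
Lemma expm_flow n (Y Y' V : R -> 'M[R]_n) :
  (forall t, 0 <= t <= 1 ->
    [/\ is_mxderive Y t (Y' t), is_mxderive V t (Y' t *m V t) &
        Y t *m Y' t = Y' t *m Y t]) ->
  (forall t, 0 <= t <= 1 -> forall i j, {for t, continuous (fun s => Y' s i j)}) ->
  Y 0 = 0 -> V 0 = 1%:M -> expm (Y 1) = V 1.
Proof.
move=> dYV cY' Y0 V0.
have [|K YK] := @nrm_bounded _ _ Y 0 1 ler01.
  by move=> t t01; have [dY _ _] := dYV t t01; exact: is_mxderive_continuous dY.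
have [|L VL] := @nrm_bounded _ _ V 0 1 ler01.
  by move=> t t01; have [_ dV _] := dYV t t01; exact: is_mxderive_continuous dV.
have [M Y'M] := nrm_bounded ler01 cY'.
have E : expm (- Y 1) *m V 1 = V 0.
  apply: (expm_transport (K := Num.max K (Num.max L M)) dYV) => // t t01.
  by rewrite !le_max YK// VL// Y'M// !orbT.
by rewrite -[RHS]mul1mx -(expmN (Y 1)) -mulmxA E V0 mulmx1.
Qed.

End Exponential.

(** * Complex eigenvectors of real matrices *)

Section Conformal.
Local Open Scope classical_set_scope.
Context {R : realType}.

(** The complex number x + i y acting on real pairs, so that complex
    eigenvectors of real matrices can be handled by real analysis. *)
Definition cplx (x y : R) : 'M[R]_2 :=
  \matrix_(i, j) if i == j then x else if i == ord0 then - y else y.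

Lemma cplxP x y x' y' : x = x' -> y = y' -> cplx x y = cplx x' y'.
Proof. by move=> -> ->. Qed.

Lemma cplxD x y x' y' : cplx x y + cplx x' y' = cplx (x + x') (y + y').
Proof.
apply/matrixP => i j; rewrite !mxE.
by case: ifP => // _; case: ifP => // _; rewrite opprD.
Qed.

Lemma cplxN x y : - cplx x y = cplx (- x) (- y).
Proof.
apply/matrixP => i j; rewrite !mxE.
by case: ifP => // _; case: ifP.
Qed.

Lemma cplxB x y x' y' : cplx x y - cplx x' y' = cplx (x - x') (y - y').
Proof. by rewrite cplxN cplxD. Qed.

Lemma cplxZ c x y : c *: cplx x y = cplx (c * x) (c * y).
Proof.
apply/matrixP => i j; rewrite !mxE.
by case: ifP => // _; case: ifP; rewrite // mulrN.
Qed.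

Lemma cplxM x y x' y' :
  cplx x y *m cplx x' y' = cplx (x * x' - y * y') (x * y' + y * x').
Proof.
apply/matrixP => i j; rewrite !mxE !big_ord_recl big_ord0 !mxE.
by case: i => [[|[|i]] Hi]; case: j => [[|[|j]] Hj] //=; rewrite ?eqE/=; ring.
Qed.

Lemma cplx1 x : cplx x 0 = x%:M.
Proof.
apply/matrixP => i j; rewrite !mxE.
by case: eqP => // _; case: ifP; rewrite ?oppr0.
Qed.

Lemma cplx_mul_eq0 n x y (V : 'M[R]_(2, n)) :
  V != 0 -> cplx x y *m V = 0 -> x = 0 /\ y = 0.
Proof.
move=> V0 /(congr1 (mulmx (cplx x (- y)))); rewrite mulmxA cplxM mulmx0.
rewrite (_ : x * y + - y * x = 0) ?cplx1 ?mul_scalar_mx; last by ring.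
move/eqP; rewrite scaler_eq0 (negPf V0) orbF => /eqP; nra.
Qed.

Lemma cplx_mul_inj n x y x' y' (V : 'M[R]_(2, n)) :
  V != 0 -> cplx x y *m V = cplx x' y' *m V -> x = x' /\ y = y'.
Proof.
move=> V0 /eqP; rewrite -subr_eq0 -mulmxBl cplxB => /eqP /(cplx_mul_eq0 V0)[].
by move=> /subr0_eq -> /subr0_eq.
Qed.

Lemma is_mxderive_cplx (f g : R -> R) t f' g' :
  is_derive t (1 : R) f f' -> is_derive t (1 : R) g g' ->
  is_mxderive (fun s => cplx (f s) (g s)) t (cplx f' g').
Proof.
move=> df dg i j; under eq_fun do rewrite mxE; rewrite mxE.
by case: ifP => // _; case: ifP => // _; exact: is_deriveN dg.
Qed.

Lemma expm_cplx x y :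
  expm (cplx x y) = cplx (expR x * cos y) (expR x * sin y).
Proof.
have -> : cplx x y = (1 : R) *: cplx x y by rewrite scale1r.
rewrite (expm_flow (Y := fun t => t *: cplx x y) (Y' := fun=> cplx x y)
  (V := fun t => cplx (expR (t * x) * cos (t * y)) (expR (t * x) * sin (t * y)))).
- by rewrite !mul1r.
- move=> t _; have dl (a : R) : is_derive t (1 : R) (fun s => s * a) a.
    apply: is_derive_eq (is_deriveM (is_derive_id t 1) (is_derive_cst a t 1)) _.
    by rewrite scaler0 add0r /GRing.scale/= mulr1.
  split.
  + rewrite -[X in is_mxderive _ _ X]scale1r; exact: is_mxderiveZ.
  + have dexp := @is_derive1_comp _ _ (fun s => s * x) t _ _
       (is_derive_expR (t * x)) (dl x).
    have dcos := @is_derive1_comp _ _ (fun s => s * y) t _ _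
       (is_derive_cos (t * y)) (dl y).
    have dsin := @is_derive1_comp _ _ (fun s => s * y) t _ _
       (is_derive_sin (t * y)) (dl y).
    rewrite cplxM; apply: is_mxderive_cplx.
      apply: is_derive_eq (is_deriveM dexp dcos) _.
      by rewrite /GRing.scale/=; ring.
    apply: is_derive_eq (is_deriveM dexp dsin) _.
    by rewrite /GRing.scale/=; ring.
  + by rewrite -scalemxAl -scalemxAr.
- by move=> t _ i j; exact: cvg_cst.
- by rewrite scale0r.
- by rewrite !mul0r expR0 cos0 sin0 !mul1r cplx1.
Qed.

(** The moduli determine x, the cosine determines y up to sign, and the sine
    determines the sign. *)
Lemma polar_inj (x y x' y' : R) : - pi < y < pi -> - pi < y' < pi ->
  expR x * cos y = expR x' * cos y' -> expR x * sin y = expR x' * sin y' ->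
  x = x' /\ y = y'.
Proof.
move=> yB y'B ec es.
have exx' : expR x = expR x'.
  have := cos2Dsin2 y; have := cos2Dsin2 y'.
  have := expR_gt0 x; have := expR_gt0 x'.
  have : (expR x * cos y) ^+ 2 + (expR x * sin y) ^+ 2 =
     (expR x' * cos y') ^+ 2 + (expR x' * sin y') ^+ 2 by rewrite ec es.
  rewrite !exprMn -!mulrDr => /[swap] p' /[swap] p /[swap] -> /[swap] ->.
  by rewrite !mulr1 => /eqP; rewrite eqrXn2 ?ltW// => /eqP.
have xx' : x = x' by exact: expR_inj.
have e0 : expR x != 0 by rewrite gt_eqF// expR_gt0.
move: ec es; rewrite -exx' => /(mulfI e0) ec /(mulfI e0) es; split=> //.
have cn (z : R) : cos z = cos `|z|.
  by have [z0|z0] := ger0P z; rewrite ?cosN.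
have ay : `|y| = `|y'|.
  apply: cos_inj; rewrite -?cn// in_itv/= normr_ge0/= ltW// ltr_norml//.
have [//|yN] : y = y' \/ y = - y'.
  by move: ay; case: (ger0P y); case: (ger0P y') => _ _ e; lra.
have sy0 : sin y' = 0 by move: es; rewrite yN sinN; lra.
have [|y0] := eqVneq `|y'| 0; first by move=> /normr0_eq0 y0; rewrite yN y0 oppr0.
have : 0 < sin `|y'|.
  by apply: sin_gt0_pi; rewrite lt_neqAle eq_sym y0 normr_ge0/= ltr_norml.
by case: (ger0P y') => _; rewrite ?sinN sy0 ?oppr0 ltxx.
Qed.

End Conformal.

Section Eigenvectors.
Context {C : numClosedFieldType}.

Lemma stable_eigenvector n (W X : 'M[C]_n) : W != 0 -> stablemx W X ->
  exists v : 'rV_n, [/\ v != 0, (v <= W)%MS & exists a, v *m X = a *: v].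
Proof.
move=> W0 sW.
have [|a /eigenvalueP[u ua u0]] := eigenvalue_closed (conjmx (row_base W) X).
  by rewrite lt0n mxrank_eq0.
exists (u *m row_base W); split.
- by rewrite mulmx_free_eq0 ?row_base_free.
- by rewrite (submx_trans (submxMl _ _))// eq_row_base.
have : stablemx u (conjmx (row_base W) X) by rewrite ua scalemx_sub.
rewrite stablemx_restrict// => /eigenvectorP[b /eigenspaceP ub].
by exists b.
Qed.

Lemma stable_common_eigenvector n (W X Y : 'M[C]_n) : W != 0 ->
  stablemx W X -> stablemx W Y -> X *m Y = Y *m X ->
  exists v : 'rV_n, [/\ v != 0, (v <= W)%MS,
    exists a, v *m X = a *: v & exists b, v *m Y = b *: v].
Proof.
move=> W0 sX sY cXY.
have [u [u0 uW [a ua]]] := stable_eigenvector W0 sX.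
have W'0 : (W :&: eigenspace X a)%MS != 0.
  apply: contraNneq u0 => W'0; rewrite -submx0 -W'0 sub_capmx uW.
  exact/eigenspaceP.
have sW' : stablemx (W :&: eigenspace X a)%MS Y.
  rewrite sub_capmx (submx_trans (submxMr _ (capmxSl _ _)) sY).
  rewrite (submx_trans (submxMr _ (capmxSr _ _)))//.
  exact: comm_mx_stable_eigenspace.
have [v [v0 vW' vY]] := stable_eigenvector W'0 sW'.
exists v; split=> //; first exact: submx_trans vW' (capmxSl _ _).
by exists a; apply/eigenspaceP; exact: submx_trans vW' (capmxSr _ _).
Qed.

End Eigenvectors.

Section Realification.
Context {R : realType}.

Definition realify n (v : 'rV[R[i]]_n) : 'M[R]_(2, n) :=
  \matrix_(k, j) if k == ord0 then complex.Re (v 0 j) else complex.Im (v 0 j).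

Lemma realify_eq0 n (v : 'rV[R[i]]_n) : realify v = 0 -> v = 0.
Proof.
move=> /matrixP v0; apply/rowP => j; have := v0 ord0 j; have := v0 ord_max j.
by rewrite !mxE/=; case: (v 0 j) => x y /= -> ->.
Qed.

Lemma realifyM n m (v : 'rV[R[i]]_n) (X : 'M[R]_(n, m)) :
  realify (v *m map_mx (real_complex R) X) = realify v *m X.
Proof.
apply/matrixP => k j; rewrite !mxE.
have -> : complex.Re (\sum_l v 0 l * map_mx (real_complex R) X l j) =
    \sum_l complex.Re (v 0 l) * X l j.
  rewrite (big_morph (@complex.Re R) (id1 := 0) (op1 := +%R))//.
    by apply: eq_bigr => l _; rewrite mxE; case: (v 0 l) => x y /=; ring.
  by move=> [? ?] [? ?].
have -> : complex.Im (\sum_l v 0 l * map_mx (real_complex R) X l j) =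
    \sum_l complex.Im (v 0 l) * X l j.
  rewrite (big_morph (@complex.Im R) (id1 := 0) (op1 := +%R))//.
    by apply: eq_bigr => l _; rewrite mxE; case: (v 0 l) => x y /=; ring.
  by move=> [? ?] [? ?].
by case: ifP => k0; apply: eq_bigr => l _; rewrite !mxE k0.
Qed.

Lemma realifyZ n (z : R[i]) (v : 'rV[R[i]]_n) :
  realify (z *: v) = cplx (complex.Re z) (complex.Im z) *m realify v.
Proof.
apply/matrixP => k j; rewrite !mxE !big_ord_recl big_ord0 !mxE/=.
case: z (v 0 j) => x y [u w] /=.
by case: k => [[|[|k]] Hk] //=; rewrite ?eqE/=; ring.
Qed.

Lemma realify_eigen n (v : 'rV[R[i]]_n) (X : 'M[R]_n) z :
  v *m map_mx (real_complex R) X = z *: v ->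
  realify v *m X = cplx (complex.Re z) (complex.Im z) *m realify v.
Proof. by rewrite -realifyM => ->; exact: realifyZ. Qed.

End Realification.

(** * Injectivity of the exponential on the strip *)

Section Uniqueness.
Local Open Scope classical_set_scope.
Context {R : realType}.

Definition in_strip n (X : 'M[R]_n) : Prop :=
  forall z : R[i], ceigenvalue X z -> - pi < complex.Im z < pi.

(** The block V = W (X - L) plays the part of a common eigenvector of X and L with
    a common eigenvalue T. All terms X^i (X - L) L^(j-1-i) of the telescoping sum
    for X^j - L^j then act on W in the same way, as T^(j-1) V, and the series for
    exp X - exp L turns into the one for the derivative of exp at T. *)
Lemma sub_expm_part m n (L X : 'M[R]_n) (T : 'M[R]_m) (W : 'M[R]_(m, n)) k :
  L *m X = X *m L ->
  W *m (X - L) *m X = T *m (W *m (X - L)) ->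
  W *m (X - L) *m L = T *m (W *m (X - L)) ->
  W *m (expm_part k.+1 X - expm_part k.+1 L) =
  expm_part k T *m (W *m (X - L)).
Proof.
move=> cLX VX VL; set V := W *m (X - L) in VX VL *.
have pow j : W *m (X ^+ j.+1 - L ^+ j.+1) = j.+1%:R *: (T ^+ j *m V).
  elim: j => [|j IHj]; first by rewrite !expr1 expr0 mul1mx scale1r.
  have -> : X ^+ j.+2 - L ^+ j.+2 =
      (X ^+ j.+1 - L ^+ j.+1) *m X + (X - L) *m L ^+ j.+1.
    rewrite !mulmxBl [X ^+ j.+2]exprSr [L ^+ j.+2]exprS.
    rewrite (intertwineX (X := L) (Y := L) (W := X))//.
    by rewrite addrA subrK.
  rewrite mulmxDr mulmxA IHj mulmxA -/V -scalemxAl -mulmxA VX mulmxA.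
  rewrite -[T ^+ j *m T]exprSr -(intertwineX (X := T))//.
  by rewrite -[in RHS]natr1 scalerDl scale1r.
rewrite /expm_part !big_nat_recl// /expm_term !expr0.
rewrite opprD addrACA subrr add0r -sumrB mulmx_sumr mulmx_suml.
apply: eq_bigr => j _; rewrite -scalerBr -scalemxAr pow scalerA -scalemxAl.
by rewrite factS natrM invfM mulrAC mulVf ?mul1r// pnatr_eq0.
Qed.

(** If X and L differ, the range of X - L contains a common eigenvector w (X - L)
    of both. Equality of the exponentials forces its two eigenvalues to coincide,
    because both lie in the strip where the exponential is injective; then
    w (exp X - exp L) is exp(lambda) w (X - L), which is not 0. *)
Lemma expm_strip_inj n (X L : 'M[R]_n) : L *m X = X *m L -> expm X = expm L ->
  in_strip X -> in_strip L -> X = L.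
Proof.
move=> cLX eXL sX sL; apply/eqP; rewrite -subr_eq0; apply/negP => /negP D0.
pose c := map_mx (real_complex R).
have cM (m p q : nat) (A : 'M[R]_(m, p)) (B : 'M[R]_(p, q)) :
    c _ _ (A *m B) = c _ _ A *m c _ _ B by exact: map_mxM.
have cD0 : c _ _ (X - L) != 0 by rewrite map_mx_eq0.
have cXD : (X - L) *m X = X *m (X - L) by rewrite mulmxBl mulmxBr cLX.
have cLD : (X - L) *m L = L *m (X - L) by rewrite mulmxBl mulmxBr cLX.
have [||| v [v0 /submxP[w vE] [a va] [b vb]]] :=
    @stable_common_eigenvector _ n (c _ _ (X - L)) (c _ _ X) (c _ _ L) cD0.
- by rewrite -cM cXD cM submxMl.
- by rewrite -cM cLD cM submxMl.
- by rewrite -!cM cLX.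
have stripE z (Y : 'M[R]_n) : in_strip Y -> v *m c _ _ Y = z *: v ->
    - pi < complex.Im z < pi.
  by move=> sY vY; apply: sY; apply/eigenvalueP; exists v.
have := stripE _ _ sX va; have := stripE _ _ sL vb.
move: (realify_eigen va) (realify_eigen vb).
have V0 : realify v != 0 by apply: contra_neq v0; exact: realify_eq0.
have VE : realify v = realify w *m (X - L) by rewrite vE realifyM.
move: V0; move: (realify v) VE => V VE V0.
case: a {va} => x y; case: b {vb} => x' y'; rewrite /= => VX VL yB' yB.
have [e1 e2] : x = x' /\ y = y'.
  have eX := expm_intertwine (esym VX); have eL := expm_intertwine (esym VL).
  have := etrans eX (etrans (congr1 (mulmx V) eXL) (esym eL)).
  by rewrite !expm_cplx => /(cplx_mul_inj V0)[]; exact: polar_inj.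
subst x' y'; set T := cplx x y in VX VL.
suff TV : expm T *m V = 0.
  by move: V0; rewrite -(mul1mx V) -(expmN (- T)) opprK -mulmxA TV mulmx0 eqxx.
have l1 : expm_part k T *m V @[k --> \oo] --> expm T *m V.
  by apply: cvg_mulmx (@expm_cvg _ _ T) _; exact: cvg_cst.
apply: (cvg_unique _ l1) => //=.
have -> : 0 = realify w *m (expm X - expm L) by rewrite eXL subrr mulmx0.
have E k : expm_part k T *m V =
    realify w *m (expm_part k.+1 X - expm_part k.+1 L).
  by rewrite (@sub_expm_part _ _ _ _ T)// -VE.
under eq_fun do rewrite E.
apply: cvg_mulmx; first exact: cvg_cst.
apply: cvgB.
  by rewrite (cvg_shiftS (expm_part^~ X)); exact: expm_cvg.
by rewrite (cvg_shiftS (expm_part^~ L)); exact: expm_cvg.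
Qed.

End Uniqueness.

(** * The logarithm as a primitive of the resolvent *)

Section Resolvent.
Local Open Scope classical_set_scope.
Context {R : realType}.

Lemma continuous_det n (G : R -> 'M[R]_n) t :
  (forall i j, {for t, continuous (fun s => G s i j)}) ->
  {for t, continuous (fun s => \det (G s))}.
Proof.
move=> cG; rewrite /prop_for /continuous_at /determinant.
apply: (@cvg_big _ _ +%R) => [|s _]; first exact: add_continuous.
apply: cvgM; first exact: cvg_cst.
apply: (@cvg_big R _ ( *%R : R -> R -> R)) => [|i _]; last exact: cG.
exact: mul_continuous.
Qed.

Lemma continuous_invmx n (G : R -> 'M[R]_n) t :
  (forall s, G s \in unitmx) ->
  (forall i j, {for t, continuous (fun s => G s i j)}) ->
  forall i j, {for t, continuous (fun s => invmx (G s) i j)}.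
Proof.
move=> uG cG i j; rewrite /prop_for /continuous_at.
have E s : invmx (G s) i j = (\det (G s))^-1 * cofactor (G s) j i.
  by rewrite /invmx uG !mxE.
under eq_fun do rewrite E; rewrite E.
apply: cvgM.
  apply: cvgV; last exact: continuous_det.
  by have := uG t; rewrite unitmxE unitfE.
rewrite /cofactor; apply: cvgM; first exact: cvg_cst.
apply: continuous_det => k l; rewrite /prop_for /continuous_at.
by under eq_fun do rewrite !mxE; rewrite !mxE; exact: cG.
Qed.

Lemma primitive_exists (f : R -> R) : continuous f ->
  exists2 F : R -> R, F 0 = 0 & forall t : R, -1 < t -> is_derive t (1 : R) F (f t).
Proof.
move=> cf.
(* Integrating from -1 makes 0 an interior point. *)
pose F t := (\int[lebesgue_measure]_(x in `[(-1)%R, t]) f x)%R.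
exists (fun t => F t - F 0) => [|t t1]; first by rewrite subrr.
have fi : lebesgue_measure.-integrable `[(-1)%R, (t + 1)%R] (EFin \o f).
  apply: continuous_compact_integrable; first exact: segment_compact.
  exact: continuous_subspaceT.
have [dF F'] := @continuous_FTC1_closed R f (-1) t (t + 1)
  (ltr_pwDr ltr01 (lexx t)) fi t1 (cf t).
rewrite -[X in is_derive _ _ _ X]subr0; apply: is_deriveB.
exact: DeriveDef dF (etrans (esym (derive1E F t)) F').
Qed.

Lemma mx_primitive_exists m n (Q : R -> 'M[R]_(m, n)) :
  (forall i j, continuous (fun s => Q s i j)) ->
  exists2 G : R -> 'M[R]_(m, n), G 0 = 0 &
    forall t : R, -1 < t -> is_mxderive G t (Q t).
Proof.
move=> cQ; have /choice[F FP] : forall ij : 'I_m * 'I_n, exists F : R -> R,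
    F 0 = 0 /\ forall t : R, -1 < t -> is_derive t (1 : R) F (Q t ij.1 ij.2).
  by move=> ij; have [F F0 dF] := primitive_exists (cQ ij.1 ij.2); exists F.
exists (fun t => \matrix_(i, j) F (i, j) t) => [|t t1].
  by apply/matrixP => i j; rewrite !mxE (FP (i, j)).1.
move=> i j; under eq_fun do rewrite mxE.
exact: (FP (i, j)).2 t t1.
Qed.

Definition off_slit n (A : 'M[R]_n) : Prop :=
  forall z : R[i], ceigenvalue A z -> ~ (complex.Im z = 0 /\ complex.Re z <= 0).

Section Path.
Context {n : nat} (A : 'M[R]_n).
Hypothesis hA : off_slit A.

Definition segment_path (t : R) : 'M[R]_n := 1%:M + t *: (A - 1%:M).

Lemma segment_path_unit t : 0 <= t <= 1 -> segment_path t \in unitmx.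
Proof.
move=> /andP[t0 t1]; rewrite unitmxE unitfE; apply/negP => /det0P[v v0].
rewrite mulmxDr mulmx1 -scalemxAr mulmxBr mulmx1 => vt.
have tn0 : t != 0.
  by apply: contra_eq_neq vt => ->; rewrite scale0r addr0.
apply: (hA (z := real_complex R (1 - t^-1))).
  rewrite /ceigenvalue eigenvalue_map; apply/eigenvalueP; exists v => //.
  have -> : v *m A = v + t^-1 *: (t *: (v *m A - v)).
    by rewrite scalerA mulVf// scale1r addrC subrK.
  have -> : t *: (v *m A - v) = - v.
    by apply/eqP; rewrite -addr_eq0 addrC vt.
  by rewrite scalerN scalerBl scale1r.
split=> //=; rewrite subr_le0 invf_ge1//.
by rewrite lt_neqAle eq_sym tn0.
Qed.

Lemma segment_path_comm (Z : 'M[R]_n) t : Z *m A = A *m Z ->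
  Z *m segment_path t = segment_path t *m Z.
Proof.
move=> cZ; rewrite mulmxDr mulmxDl mulmx1 mul1mx -scalemxAr -scalemxAl.
by rewrite mulmxBr mulmxBl mulmx1 mul1mx cZ.
Qed.

Lemma invmx_comm (Z M : 'M[R]_n) : M \in unitmx -> Z *m M = M *m Z ->
  Z *m invmx M = invmx M *m Z.
Proof.
move=> uM cZ; rewrite -[LHS]mul1mx -(mulVmx uM) -!mulmxA; congr (_ *m _).
by rewrite mulmxA -cZ -mulmxA mulmxV// mulmx1.
Qed.

(** Clamping the parameter makes the resolvent a continuous function on the whole
    line, so that its primitive is differentiable on both sides of 0 and 1. *)
Definition clamp (t : R) : R := Num.max 0 (Num.min t 1).

Lemma clamp_itv t : 0 <= clamp t <= 1.
Proof. by rewrite /clamp le_max lexx/= ge_max ler01/= ge_min lexx orbT. Qed.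

Lemma clampE t : 0 <= t <= 1 -> clamp t = t.
Proof. by move=> /andP[t0 t1]; rewrite /clamp min_l// max_r. Qed.

Lemma continuous_clamp : continuous clamp.
Proof.
move=> t; apply: (@continuous_max R R (cst 0) (fun s => Num.min s 1)).
  exact: cvg_cst.
apply: (@continuous_min R R id (cst 1)); first exact: cvg_id.
exact: cvg_cst.
Qed.

Definition resolvent (t : R) : 'M[R]_n := invmx (segment_path (clamp t)).

Lemma continuous_resolvent i j : continuous (fun s => resolvent s i j).
Proof.
move=> t; apply: (continuous_invmx (G := segment_path \o clamp)).
  by move=> s; apply: segment_path_unit; exact: clamp_itv.
move=> k l; rewrite /prop_for /continuous_at /= /segment_path.
under eq_fun do rewrite !mxE; rewrite !mxE; apply: cvgD; first exact: cvg_cst.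
by apply: cvgM; [exact: continuous_clamp|exact: cvg_cst].
Qed.

Lemma resolventE t : 0 <= t <= 1 -> resolvent t = invmx (segment_path t).
Proof. by move=> t01; rewrite /resolvent clampE. Qed.

Section Logarithm.
Variable P : R -> 'M[R]_n.
Hypothesis P0 : P 0 = 0.
Hypothesis dP : forall t, 0 <= t <= 1 -> is_mxderive P t (resolvent t).

Let L t := (A - 1%:M) *m P t.

Lemma resolvent_primitive_comm (Z : 'M[R]_n) t : Z *m A = A *m Z ->
  0 <= t <= 1 -> Z *m P t = P t *m Z.
Proof.
move=> cZ /andP[t0 t1]; apply: subr0_eq.
rewrite (is_mxderive_0_is_cst (G := fun s => Z *m P s - P s *m Z) t0) => [|s].
  by rewrite P0 mulmx0 mul0mx subrr.
move=> /andP[s0 st]; have s01 : 0 <= s <= 1 by rewrite s0 (le_trans st).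
apply: is_mxderive_eq
  (is_mxderiveB (is_mxderiveMl Z (dP s01)) (is_mxderiveMr Z (dP s01))) _.
rewrite resolventE// (invmx_comm (segment_path_unit s01)) ?subrr//.
exact: segment_path_comm.
Qed.

Lemma comm_sub1 (Z : 'M[R]_n) :
  Z *m A = A *m Z -> Z *m (A - 1%:M) = (A - 1%:M) *m Z.
Proof. by move=> cZ; rewrite mulmxBr mulmxBl mulmx1 mul1mx cZ. Qed.

Lemma log_path_comm (Z : 'M[R]_n) t : Z *m A = A *m Z ->
  0 <= t <= 1 -> Z *m L t = L t *m Z.
Proof.
move=> cZ t01; rewrite /L mulmxA comm_sub1// -!mulmxA.
by rewrite resolvent_primitive_comm.
Qed.

Lemma is_mxderive_log_path t : 0 <= t <= 1 ->
  is_mxderive L t ((A - 1%:M) *m resolvent t).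
Proof. by move=> t01; exact: is_mxderiveMl (dP t01). Qed.

Lemma expm_log_path : expm (L 1) = A.
Proof.
rewrite (expm_flow (Y' := fun t => (A - 1%:M) *m resolvent t)
  (V := segment_path)).
- by rewrite /segment_path scale1r addrC subrK.
- move=> t t01; split; first exact: is_mxderive_log_path.
    apply: is_mxderive_eq (is_mxderiveD (is_mxderive_cst _ _)
      (is_mxderiveZ _ (is_derive_id _ _))) _.
    by rewrite resolventE// -mulmxA mulVmx ?segment_path_unit// mulmx1 add0r scale1r.
  have c1 : L t *m A = A *m L t by apply/esym; exact: log_path_comm.
  have c2 := invmx_comm (segment_path_unit t01) (segment_path_comm t c1).
  by rewrite resolventE// mulmxA comm_sub1// -(mulmxA _ (L t)) c2 mulmxA.
- move=> t _ i j; rewrite /prop_for /continuous_at.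
  under eq_fun do rewrite mxE; rewrite mxE.
  apply: (@cvg_big _ _ +%R) => [|k _]; first exact: add_continuous.
  by apply: cvgM; [exact: cvg_cst|exact: continuous_resolvent].
- by rewrite /L P0 mulmx0.
- by rewrite /segment_path scale0r addr0.
Qed.

(** On a common eigenvector with eigenvalue mu = x + i y of A, the curve L acts as
    the branch of log (1 + t (mu - 1)) that vanishes at 0. The imaginary part of
    this branch is 0 when y = 0, and otherwise the increment of
    atan ((k t + x - 1) / y) where k = |mu - 1|^2. This primitive of
    y / |1 + t (mu - 1)|^2 is smooth on the whole line and varies by less than pi. *)
Lemma log_path_strip : in_strip (L 1).
Proof.
move=> z zL; pose c := map_mx (real_complex R).
have i01 : 0 <= (1 : R) <= 1 by rewrite ler01 lexx.
have cAL : A *m L 1 = L 1 *m A by exact: log_path_comm.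
have ccAL : c _ _ (L 1) *m c _ _ A = c _ _ A *m c _ _ (L 1).
  by rewrite -!map_mxM cAL.
have sA := comm_mx_stable_eigenspace z ccAL.
have sL := comm_mx_stable_eigenspace z (erefl (c _ _ (L 1) *m c _ _ (L 1))).
have [v [v0 /eigenspaceP vL [mu vA] _]] :=
  stable_common_eigenvector zL sA sL (esym ccAL).
have muA : ~ (complex.Im mu = 0 /\ complex.Re mu <= 0).
  by apply: hA; apply/eigenvalueP; exists v.
have V0 : realify v != 0 by apply: contra_neq v0; exact: realify_eq0.
move: V0 (realify_eigen vL) (realify_eigen vA); move: (realify v) => V V0.
case: mu muA {vA} => x y; case: z {zL vL sA sL} => z1 z2 /= muA VL VA.
(* q t = |1 + t (mu - 1)|^2, so that ln (q t) / 2 and g t are, up to a constant,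
   the real and imaginary parts of the logarithm. *)
pose p := x - 1; pose k := p ^+ 2 + y ^+ 2.
pose q t := (1 + t * p) ^+ 2 + (t * y) ^+ 2.
have q0 t : 0 <= t <= 1 -> 0 < q t.
  move=> /andP[t0 t1]; rewrite lt_neqAle addr_ge0 ?sqr_ge0// andbT eq_sym.
  apply/negP => /eqP /eqP; rewrite paddr_eq0 ?sqr_ge0// !sqrf_eq0 => /andP[/eqP u].
  rewrite mulf_eq0 => /orP[/eqP t00|/eqP y0].
    by move: u; rewrite t00; lra.
  by apply: muA; split=> //; move: u; rewrite /p; nra.
pose g t := if y == 0 then 0 else atan ((k * t + p) / y).
have VB : V *m (A - 1%:M) = cplx p y *m V.
  rewrite mulmxBr VA mulmx1 -[X in _ - X]mul1mx -cplx1 -mulmxBl cplxB.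
  by rewrite subr0.
have VP t : V *m segment_path t = cplx (1 + t * p) (t * y) *m V.
  rewrite mulmxDr mulmx1 -scalemxAr VB scalemxAl cplxZ -[X in X + _]mul1mx -cplx1.
  by rewrite -mulmxDl cplxD add0r.
pose G t := V *m L t - cplx (ln (q t) / 2) (g t) *m V.
have dG t : 0 <= t <= 1 -> is_mxderive G t 0.
  move=> t01; have qt := q0 t t01.
  have dq : is_derive t (1 : R) q (2 * (p + t * k)).
    have dl (a : R) : is_derive t (1 : R) (fun s => s * a) a.
      apply: is_derive_eq (is_deriveM (is_derive_id t 1) (is_derive_cst a t 1)) _.
      by rewrite scaler0 add0r /GRing.scale/= mulr1.
    have d1 : is_derive t (1 : R) (fun s => 1 + s * p) (0 + p).
      exact: is_deriveD (is_derive_cst (1 : R) t 1) (dl p).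
    apply: is_derive_eq
      (is_deriveD (is_deriveM d1 d1) (is_deriveM (dl y) (dl y))) _.
    by rewrite /GRing.scale/= /k; ring.
  have dr : is_derive t (1 : R) (fun s => ln (q s) / 2) ((p + t * k) / q t).
    have := is_derive1_comp (is_derive1_ln qt) dq.
    move=> /is_deriveM /(_ (is_derive_cst (2^-1 : R) t 1)) H.
    apply: is_derive_eq H _.
    rewrite scaler0 add0r /GRing.scale/=; field; exact: lt0r_neq0.
  have dg : is_derive t (1 : R) g (y / q t).
    rewrite /g; case: eqVneq => [->|y0].
      by rewrite mul0r; exact: (is_derive_cst (0 : R)).
    have dl : is_derive t (1 : R) (fun s => (k * s + p) / y) (k / y).
      have dk := is_deriveM (is_derive_cst k t 1) (is_derive_id t 1).
      have dkp := is_deriveD dk (is_derive_cst p t 1).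
      apply: is_derive_eq (is_deriveM dkp (is_derive_cst y^-1 t 1)) _.
      by rewrite !scaler0 addr0 add0r addr0 /GRing.scale/= mulr1 mulrC.
    apply: is_derive_eq (is_derive1_comp (is_derive1_atan _) dl) _.
    have k0 : k != 0.
      by rewrite /k paddr_eq0 ?sqr_ge0// negb_and !sqrf_eq0 y0 orbT.
    have E : y ^+ 2 + (k * t + p) ^+ 2 = k * q t by rewrite /k /q; ring.
    have -> : (1 + ((k * t + p) / y) ^+ 2) = k * q t / y ^+ 2.
      by rewrite -E; field.
    by field; rewrite k0 y0 lt0r_neq0.
  apply: is_mxderive_eq (is_mxderiveB (is_mxderiveMl V (is_mxderive_log_path t01))
    (is_mxderiveMr V (is_mxderive_cplx dr dg))) _.
  rewrite mulmxA VB -[X in _ - _ *m X]mulmx1 -(mulmxV (segment_path_unit t01)).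
  rewrite [V *m (_ *m _)]mulmxA VP resolventE// !mulmxA cplxM -mulmxBl.
  rewrite (_ : cplx _ _ *m V - _ = 0) ?mul0mx//.
  apply/eqP; rewrite subr_eq0; apply/eqP; congr (_ *m V).
  have qn : (1 + t * p) ^+ 2 + (t * y) ^+ 2 != 0 by exact: lt0r_neq0 qt.
  by apply: cplxP; rewrite /k /q; field.
have := is_mxderive_0_is_cst ler01 dG.
rewrite /G {2}/L P0 !mulmx0 sub0r VL -!mulNmx -mulmxDl cplxN cplxN cplxD.
move=> /(cplx_mul_inj V0)[_] /eqP.
rewrite subr_eq => /eqP ->; rewrite /g; case: eqVneq => [_|y0].
  by rewrite oppr0 addr0 oppr_lt0 pi_gt0.
have := @atan_ltpi2 R ((k * 1 + p) / y); have := @atan_gtNpi2 R ((k * 1 + p) / y).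
have := @atan_ltpi2 R ((k * 0 + p) / y); have := @atan_gtNpi2 R ((k * 0 + p) / y).
lra.
Qed.

End Logarithm.

End Path.

End Resolvent.

(** * Norm estimates of the two tails *)

Section Tails.
Context {R : realType} {n : nat} (A : 'M[R]_n).
Hypothesis hA : off_slit A.
Variable P : R -> 'M[R]_n.
Hypothesis P0 : P 0 = 0.
Hypothesis dP : forall t, 0 <= t <= 1 -> is_mxderive P t (resolvent A t).

(** L(1) is a principal logarithm of A, so the choice made by logm is meaningful;
    the matrix X chosen commutes with A = exp X, hence with L(1), and equals it by
    injectivity. *)
Lemma logmE : logm A = (A - 1%:M) *m P 1.
Proof.
have i01 : 0 <= (1 : R) <= 1 by rewrite ler01 lexx.
have pL : is_principal_log A ((A - 1%:M) *m P 1).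
  split; first exact: (expm_log_path hA P0 dP).
  exact: (log_path_strip hA P0 dP).
have [eX sX] : is_principal_log A (logm A).
  apply: (@getPex _ [set X | is_principal_log A X]%classic).
  by exists ((A - 1%:M) *m P 1).
have cX : logm A *m A = A *m logm A.
  by have := expm_intertwine (erefl (logm A *m logm A)); rewrite eX.
apply: expm_strip_inj; [|by rewrite eX pL.1|exact: sX|exact: pL.2].
by rewrite (log_path_comm hA P0 dP cX i01).
Qed.

Variable N : 'M[R]_n -> R.
Hypothesis hN : consistent_norm N.

Lemma consistent_norm_seminorm : seminorm N.
Proof. by split; [exact: consistent_normZ|exact: consistent_normD]. Qed.

Let N_ge0 := seminorm_ge0 consistent_norm_seminorm.

(** The identity X = B - t X B bounds X = B (I + t B)^-1 by N(B) / (1 - u), where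
    u = t N(B) <= 1/2, hence by N(B) (1 + 2 u). With v = a N(B), the integral of
    this bound is v + v^2 <= 3/2 v. *)
Lemma lower_tail a : 0 <= a <= 1 -> a * N (A - 1%:M) <= 1 / 2 ->
  N ((A - 1%:M) *m P a - (A - 1%:M) *m P 0) <= 3 / 2 * a * N (A - 1%:M).
Proof.
move=> /andP[a0 a1] aB; set B := A - 1%:M in aB *; set beta := N B in aB *.
have b0 : 0 <= beta by exact: N_ge0.
pose g t := beta * t + beta ^+ 2 * (t * t).
pose g' t := beta * (1 + 2 * (t * beta)).
apply: (@le_trans _ _ (g a - g 0)); last first.
  rewrite /g !mulr0 addr0 subr0.
  have : 0 <= a * beta by exact: mulr_ge0.
  by nra.
have sub01 t : 0 <= t <= a -> 0 <= t <= 1.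
  by move=> /andP[-> ta]; exact: le_trans a1.
apply: (seminorm_mean_value (G := fun t => B *m P t)
  (G' := fun t => B *m resolvent A t) (g' := g') consistent_norm_seminorm a0) => t.
- by move=> /sub01 t01; exact: is_mxderive_log_path.
- move=> _; have d1 := is_derive_id t (1 : R).
  apply: is_derive_eq
    (is_deriveD (is_deriveZ beta d1) (is_deriveZ (beta ^+ 2) (is_deriveM d1 d1))) _.
  by rewrite /g' /GRing.scale/=; ring.
move=> t0a; have t01 := sub01 t t0a; move: t0a => /andP[t0 ta].
set X := B *m _.
have XE : X = B - t *: (X *m B).
  apply/eqP; rewrite eq_sym subr_eq; apply/eqP.
  rewrite -[LHS]mulmx1 -(mulVmx (segment_path_unit hA t01)) mulmxA -resolventE//.
  by rewrite -/X /segment_path -/B mulmxDr mulmx1 -scalemxAr.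
have : N X <= beta + t * (N X * beta).
  rewrite {1}XE; apply: le_trans (seminormB consistent_norm_seminorm _ _) _.
  rewrite (consistent_normZ hN) ger0_norm// lerD2l ler_wpM2l//.
  exact: (consistent_normM hN).
have X0 : 0 <= N X by exact: N_ge0.
have tb0 : 0 <= t * beta by exact: mulr_ge0.
have tb : t * beta <= 1 / 2 by apply: le_trans aB; rewrite ler_wpM2r.
rewrite /g' mulrCA; move: (N X) (t * beta) X0 tb0 tb => x u X0 u0 u1 H.
have : x * (1 - u) * (1 + 2 * u) <= beta * (1 + 2 * u).
  by apply: ler_wpM2r; [lra|nra].
have : 0 <= x * (u * (1 - 2 * u)) by rewrite !mulr_ge0//; lra.
by nra.
Qed.

(** The resolvent Q satisfies t Q = A^-1 - (1 - t) Q A^-1, because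
    I + t B = (1 - t) I + t A. With c = N(A^-1) and w = c (1 - t) / t <= 1/2 this
    gives N(Q) <= (c / t) (1 + 2 w). *)
Lemma upper_tail b : 0 < b <= 1 ->
  2 * N (invmx A) * (1 - b) <= b ->
  N ((A - 1%:M) *m P 1 - (A - 1%:M) *m P b) <=
  (- ln b + (1 - b) / (2 * b)) * N (A - 1%:M) * N (invmx A).
Proof.
move=> /andP[b0 b1] cb; set B := A - 1%:M; set beta := N B.
set c := N (invmx A) in cb *.
have be0 : 0 <= beta by exact: N_ge0.
have c0 : 0 <= c by exact: N_ge0.
have bn0 : b != 0 by exact: lt0r_neq0.
(* The factor (1 - t) / t^2 coming from w / t is relaxed to (1 - t) / t^3, whose
   integral over [b, 1] is exactly s^2 / 2 for s = (1 - b) / b. The hypothesis is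
   2 c s <= 1, which leaves the term s / 2 = (1 - b) / (2 b). *)
pose g t := beta * c * (ln t + 2 * c * (t^-1 - 2^-1 * (t^-1 * t^-1))).
pose g' t := beta * c * (t^-1 + 2 * c * (t^-1 * t^-1 * t^-1 - t^-1 * t^-1)).
apply: (@le_trans _ _ (g 1 - g b)); last first.
  rewrite /g ln1 invr1; set s := (1 - b) / b.
  have s0 : 0 <= s by rewrite divr_ge0// ?subr_ge0// ltW.
  have cs : c * s <= 1 / 2 by rewrite /s mulrA ler_pdivrMr//; lra.
  have -> : (1 - b) / (2 * b) = s / 2 by rewrite /s; field.
  have -> : b^-1 = 1 + s by rewrite /s; field.
  have cs' : 0 <= 1 / 2 - c * s by lra.
  have H := mulr_ge0 (mulr_ge0 be0 c0) (mulr_ge0 s0 cs').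
  by lra.
have sub01 t : b <= t <= 1 -> 0 <= t <= 1.
  by move=> /andP[bt ->]; rewrite andbT (le_trans (ltW b0)).
apply: (seminorm_mean_value (G := fun t => B *m P t)
  (G' := fun t => B *m resolvent A t) (g' := g') consistent_norm_seminorm b1) => t.
- by move=> /sub01 t01; exact: is_mxderive_log_path.
- move=> /andP[bt _]; have t0 : 0 < t by exact: lt_le_trans bt.
  have tn0 : t != 0 by exact: lt0r_neq0.
  have di := is_deriveV tn0 (is_derive_id t (1 : R)).
  have dh := is_deriveB di (is_deriveZ 2^-1 (is_deriveM di di)).
  apply: is_derive_eq (is_deriveZ (beta * c) (is_deriveD (is_derive1_ln t0)
    (is_deriveZ (2 * c) dh))) _.
  by rewrite /g' /GRing.scale/=; field.
move=> tb1; have t01 := sub01 t tb1; move: tb1 => /andP[bt t1].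
have t0 : 0 < t by exact: lt_le_trans bt.
set Q := resolvent A t.
have uA : A \in unitmx.
  have := segment_path_unit hA (t := 1); rewrite ler01 lexx => /(_ isT).
  by rewrite /segment_path scale1r addrC subrK.
have QE : t *: Q = invmx A - (1 - t) *: (Q *m invmx A).
  have QP : Q *m segment_path A t = 1%:M.
    by rewrite /Q resolventE// mulVmx// segment_path_unit.
  have PE : segment_path A t = (1 - t)%:M + t *: A.
    by apply/matrixP => i j; rewrite !mxE; case: (i == j); ring.
  apply/eqP; rewrite eq_sym subr_eq addrC eq_sym; apply/eqP.
  rewrite -[RHS]mul1mx -QP PE mulmxDr mulmxDl mul_mx_scalar -scalemxAl.
  by rewrite -scalemxAr -scalemxAl -mulmxA mulmxV// mulmx1.
have HQ : t * N Q <= c + (1 - t) * (N Q * c).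
  have -> : t * N Q = N (t *: Q) by rewrite (consistent_normZ hN) ger0_norm// ltW.
  rewrite QE; apply: le_trans (seminormB consistent_norm_seminorm _ _) _.
  rewrite (consistent_normZ hN) ger0_norm ?subr_ge0// lerD2l ler_wpM2l ?subr_ge0//.
  exact: (consistent_normM hN).
have Q0 : 0 <= N Q by exact: N_ge0.
apply: le_trans (consistent_normM hN _ _) _; rewrite /g' -/beta -mulrA ler_wpM2l//.
have ct : 2 * c * (1 - t) <= t.
  have : 0 <= 2 * c * (t - b) by rewrite !mulr_ge0 ?subr_ge0.
  by lra.
move: (N Q) HQ Q0 => x HQ Q0.
pose w := c * (1 - t) / t.
have w0 : 0 <= w by rewrite !mulr_ge0 ?invr_ge0 ?subr_ge0// ltW.
have w1 : 2 * w <= 1 by rewrite /w !mulrA ler_pdivrMr// mul1r.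
have Hw : x * (1 - w) <= c / t.
  rewrite /w ler_pdivlMr//.
  have -> : x * (1 - c * (1 - t) / t) * t = t * x - (1 - t) * (x * c).
    by field; exact: lt0r_neq0.
  by lra.
have H1 : x <= c / t * (1 + 2 * w).
  have : x * (1 - w) * (1 + 2 * w) <= c / t * (1 + 2 * w).
    by apply: ler_wpM2r => //; lra.
  have w2 : 0 <= 1 - 2 * w by lra.
  have := mulr_ge0 Q0 (mulr_ge0 w0 w2).
  by lra.
apply: le_trans H1 _; set y := t^-1.
have y1 : 1 <= y by rewrite /y invf_ge1.
have -> : w = c * (y - 1).
  by rewrite /w /y mulrBr mulr1 mulrBr mulrBl mulr1 mulfK// lt0r_neq0.
have : 0 <= c * (c * (y * (y - 1) * (y - 1))) by rewrite !mulr_ge0//; lra.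
by lra.
Qed.

End Tails.

(** * The double-exponential substitution *)

Section DoubleExponential.
Local Open Scope classical_set_scope.
Context {R : realType}.
Implicit Types x : R.

Lemma cosh_gt0 x : 0 < cosh x.
Proof. by rewrite divr_gt0// addr_gt0// expR_gt0. Qed.

Lemma cosh_neq0 x : cosh x != 0.
Proof. by rewrite lt0r_neq0// cosh_gt0. Qed.

Lemma cosh2Bsinh2 x : cosh x ^+ 2 - sinh x ^+ 2 = 1.
Proof.
have e : expR x * expR (- x) = 1 by rewrite -expRD subrr expR0.
by rewrite -[RHS]e /cosh /sinh; field.
Qed.

Lemma is_derive_expRN x : is_derive x 1 (fun y => expR (- y)) (- expR (- x)).
Proof.
apply: is_derive_eq (is_derive1_comp (is_derive_expR (- x))
  (is_deriveN (is_derive_id x (1 : R)))) _.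
by rewrite mulrN1.
Qed.

Lemma is_derive_sinh x : is_derive x 1 (@sinh R) (cosh x).
Proof.
apply: is_derive_eq (is_deriveM
  (is_deriveB (is_derive_expR x) (is_derive_expRN x))
  (is_derive_cst (2^-1 : R) x 1)) _.
by rewrite scaler0 add0r /GRing.scale/= opprK mulrC.
Qed.

Lemma is_derive_cosh x : is_derive x 1 (@cosh R) (sinh x).
Proof.
apply: is_derive_eq (is_deriveM
  (is_deriveD (is_derive_expR x) (is_derive_expRN x))
  (is_derive_cst (2^-1 : R) x 1)) _.
by rewrite scaler0 add0r /GRing.scale/= mulrC.
Qed.

Lemma is_derive_tanh x : is_derive x 1 (@tanh R) (sech x ^+ 2).
Proof.
have c0 := cosh_neq0 x.
apply: is_derive_eq (is_deriveM (is_derive_sinh x)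
  (is_deriveV c0 (is_derive_cosh x))) _.
rewrite /GRing.scale/= /sech -[in RHS](mul1r ((cosh x)^-1 ^+ 2)).
by rewrite -(cosh2Bsinh2 x); field.
Qed.

Definition de_subst x : R := (tanh (sinh x) + 1) / 2.

Lemma de_subst_itv x : 0 < de_subst x < 1.
Proof.
have c0 := cosh_gt0 (sinh x); rewrite /de_subst /tanh.
have e1 := expR_gt0 (sinh x); have e2 := expR_gt0 (- sinh x).
have -> : (sinh (sinh x) / cosh (sinh x) + 1) / 2 =
    expR (sinh x) / (2 * cosh (sinh x)).
  have := cosh_neq0 (sinh x); rewrite /sinh /cosh => h; field.
  by move: h; rewrite mulf_eq0 invr_eq0 pnatr_eq0 orbF.
apply/andP; split; first by rewrite divr_gt0// mulr_gt0.
rewrite ltr_pdivrMr; last by rewrite mulr_gt0.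
rewrite mul1r /cosh.
by rewrite mulrCA mulfV ?pnatr_eq0// mulr1 ltrDl.
Qed.

Lemma is_derive_de_subst x :
  is_derive x 1 de_subst (cosh x * sech (sinh x) ^+ 2 / 2).
Proof.
have d := is_derive1_comp (is_derive_tanh (sinh x)) (is_derive_sinh x).
apply: is_derive_eq (is_deriveM (is_deriveD d (is_derive_cst (1 : R) x 1))
  (is_derive_cst (2^-1 : R) x 1)) _.
by rewrite scaler0 add0r addr0 /GRing.scale/=; ring.
Qed.

Lemma is_derive_continuous (f : R -> R) x d :
  is_derive x 1 f d -> {for x, continuous f}.
Proof. by move=> [df _]; apply/differentiable_continuous/derivable1_diffP. Qed.

(** The factor in front of the inverse is twice the derivative of the
    substitution, and the bracket is twice a point of the segment from I to A. *)
Lemma F_DE_E n (A : 'M[R]_n) x :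
  off_slit A ->
  F_DE A x = (cosh x * sech (sinh x) ^+ 2 / 2) *: resolvent A (de_subst x).
Proof.
move=> hA; have [s0 s1] := andP (de_subst_itv x).
have t01 : 0 <= de_subst x <= 1 by rewrite !ltW.
rewrite /F_DE resolventE//.
have -> : (1 + tanh (sinh x)) *: (A - 1%:M) + 2 *: 1%:M =
    2 *: segment_path A (de_subst x).
  rewrite /segment_path [RHS]scalerDr addrC scalerA; congr (_ + _ *: _).
  by rewrite /de_subst; field.
have u2 : (2 : R) \is a GRing.unit by rewrite unitfE.
by rewrite invmxZ ?scalerA// unitmxZ// segment_path_unit.
Qed.

Lemma mxintegral_F_DE n (A : 'M[R]_n) (P : R -> 'M[R]_n) l r :
  off_slit A ->
  (forall t, 0 <= t <= 1 -> is_mxderive P t (resolvent A t)) -> l <= r ->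
  mxintegral l r (F_DE A) = P (de_subst r) - P (de_subst l).
Proof.
move=> hA dP lr; apply/matrixP => i j; rewrite !mxE.
have [->|lnr] := eqVneq l r; first by rewrite set_itv1 Rintegral_set1 subrr.
have dF x : is_derive x 1 (fun y => P (de_subst y) i j) (F_DE A x i j).
  have [s0 s1] := andP (de_subst_itv x).
  have t01 : 0 <= de_subst x <= 1 by rewrite !ltW.
  apply: is_derive_eq (is_derive1_comp (dP _ t01 i j) (is_derive_de_subst x)) _.
  by rewrite F_DE_E// mxE mulrC.
have cf : continuous (fun x => F_DE A x i j).
  move=> x; rewrite /continuous_at.
  under eq_fun do rewrite F_DE_E// mxE; rewrite F_DE_E// mxE.
  have cs := is_derive_continuous (is_derive_sinh x).
  apply: cvgM.
    apply: cvgM; last exact: cvg_cst.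
    apply: cvgM; first exact: is_derive_continuous (is_derive_cosh x).
    have ch : sech (sinh y) @[y --> x] --> sech (sinh x).
      apply: cvgV; first exact: cosh_neq0.
      apply: (continuous_comp cs).
      exact: is_derive_continuous (is_derive_cosh (sinh x)).
    by under eq_fun do rewrite expr2; rewrite expr2; exact: cvgM.
  have cd := is_derive_continuous (is_derive_de_subst x).
  apply: (continuous_comp cd (g := fun t => resolvent A t i j)).
  exact: continuous_resolvent.
have ltlr : l < r by rewrite lt_neqAle lnr.
have cF x : {for x, continuous (fun y => P (de_subst y) i j)}.
  exact: is_derive_continuous (dF x).
rewrite /Rintegral (continuous_FTC2 ltlr (continuous_subspaceT cf)
  (F := fun y => P (de_subst y) i j)) //.
  split=> [x _||]; first by case: (dF x).
    exact: cvg_at_right_filter (cF l).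
  exact: cvg_at_left_filter (cF r).
by move=> x _; rewrite derive1E; case: (dF x).
Qed.

End DoubleExponential.

Unset Implicit Arguments.

Theorem proposition2p1 (R : realType) (n : nat) (A : 'M[R]_n)
  (hA : forall z : R[i], ceigenvalue A z ->
          ~ (complex.Im z = 0 /\ complex.Re z <= 0))
  (N : 'M[R]_n -> R) (hN : consistent_norm N)
  (hAI : A <> 1%:M)
  (l r : R) (hlr : l <= r)
  (a b : R)
  (ha : a = (tanh (sinh l) + 1) / 2)
  (hb : b = (tanh (sinh r) + 1) / 2)
  (hal : a <= 1 / (2 * N (A - 1%:M)))
  (hbr : b >= 2 * N (invmx A) / (2 * N (invmx A) + 1)) :
  N (logm A - (A - 1%:M) *m mxintegral l r (F_DE A))
  <= 3 / 2 * a * N (A - 1%:M)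
     + (- ln b + (1 - b) / (2 * b)) * N (A - 1%:M) * N (invmx A).
Proof.
have cQ i j := @continuous_resolvent R n A hA i j.
have [P P0 dP1] := mx_primitive_exists cQ.
have dP t : 0 <= t <= 1 -> is_mxderive P t (resolvent A t).
  by move=> /andP[t0 _]; apply: dP1; lra.
rewrite (mxintegral_F_DE hA dP hlr) -[de_subst r]hb -[de_subst l]ha.
rewrite (logmE hA P0 dP).
have a01 : 0 < a < 1 by rewrite ha de_subst_itv.
have b01 : 0 < b < 1 by rewrite hb de_subst_itv.
have sN := consistent_norm_seminorm hN.
have N0 : 0 < N (A - 1%:M).
  rewrite lt_neqAle seminorm_ge0// andbT eq_sym; apply/eqP.
  by move=> /(consistent_norm_eq0 hN)/eqP; rewrite subr_eq0 => /eqP.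
have c0 := seminorm_ge0 sN (invmx A).
have -> : (A - 1%:M) *m P 1 - (A - 1%:M) *m (P b - P a) =
    ((A - 1%:M) *m P a - (A - 1%:M) *m P 0) +
    ((A - 1%:M) *m P 1 - (A - 1%:M) *m P b).
  by rewrite P0 mulmx0 subr0 mulmxBr opprB addrCA.
apply: le_trans (sN.2 _ _) _; apply: lerD.
  apply: (lower_tail hA dP hN); first by case/andP: a01 => *; rewrite !ltW.
  by move: hal; rewrite ler_pdivlMr ?mulr_gt0//; lra.
apply: (upper_tail hA dP hN); first by case/andP: b01 => -> *; rewrite ltW.
by move: hbr; rewrite ler_pdivrMr; [lra|lra].
Qed.
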